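(* Let $f$ be smooth and bistable (there is $\alpha\in(0,1)$ with $f(0)=f(\alpha)=f(1)=0$, $f'(0),f'(1)<0<f'(\alpha)$, $f>0$ on $(-\infty,0)\cup(\alpha,1)$, $f<0$ on $(0,\alpha)\cup(1,\infty)$), $\tau_m=1/\sup_{[0,1]}|f'|$, and for $\tau\in(0,\tau_m)$ let $c=c_\ast(\tau)$, $(U,V)$ be the traveling wave speed and profile ($cU'+V'+f(U)=0$, $U'+c\tau V'-V=0$, $(U,V)(-\infty)=(0,0)$, $(U,V)(+\infty)=(1,0)$). Let $\mathcal{L}^\tau=-\mathbf{B}^{-1}(\mathbf{A}\partial_x+\mathbf{C}(x))$ on $L^2(\mathbb{R};\mathbb{C}^2)$ with domain $H^2(\mathbb{R};\mathbb{C}^2)$, where $\mathbf{A}=\begin{pmatrix}-c&-1\\-1&-c\tau\end{pmatrix}$, $\mathbf{B}=\mathrm{diag}(1,\tau)$, $\mathbf{C}(x)=\mathrm{diag}(-f'(U(x)),1)$. Then for each $\tau\in(0,\tau_m)$, $\lambda=0$ is an eigenvalue of $\mathcal{L}^\tau$ with geometric multiplicity equal to one, and its eigenspace is generated by $(U_x,V_x)^\top\in H^2(\mathbb{R};\mathbb{C}^2)$.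
   Context: The traveling wave is unique up to translation; a fixed translate is used. *)

(* Defs.v *)
From Stdlib Require Import Reals.
From Coquelicot Require Import Coquelicot.
Open Scope R_scope.

Definition smooth (f : R -> R) : Prop := forall (n : nat) (x : R), ex_derive_n f n x.

Definition bistable (f : R -> R) : Prop :=
  exists alpha : R, 0 < alpha < 1 /\
    f 0 = 0 /\ f alpha = 0 /\ f 1 = 0 /\
    Derive f 0 < 0 /\ Derive f 1 < 0 /\ 0 < Derive f alpha /\
    (forall u, u < 0 -> 0 < f u) /\ (forall u, alpha < u < 1 -> 0 < f u) /\
    (forall u, 0 < u < alpha -> f u < 0) /\ (forall u, 1 < u -> f u < 0).

Definition tau_m (f : R -> R) : R :=
  / real (Lub_Rbar (fun y => exists u, 0 <= u <= 1 /\ y = Rabs (Derive f u))).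

Definition traveling_wave (f : R -> R) (tau c : R) (U V : R -> R) : Prop :=
  (forall x, ex_derive U x /\ ex_derive V x) /\
  (forall x, c * Derive U x + Derive V x + f (U x) = 0) /\
  (forall x, Derive U x + c * tau * Derive V x - V x = 0) /\
  is_lim U m_infty 0 /\ is_lim V m_infty 0 /\
  is_lim U p_infty 1 /\ is_lim V p_infty 0.

Definition L2C (g : R -> C) : Prop :=
  ex_RInt_gen (fun x => (Cmod (g x)) ^ 2) (Rbar_locally m_infty) (Rbar_locally p_infty).

(* h is in H^2(R; C) (classical version: h twice differentiable with continuous
   second derivative, h, h', h'' in L^2). *)
Definition H2C (h : R -> C) : Prop :=
  exists h1 h2 : R -> C,
    (forall x, is_derive h x (h1 x)) /\
    (forall x, is_derive h1 x (h2 x)) /\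
    (forall x, continuous h2 x) /\
    L2C h /\ L2C h1 /\ L2C h2.

Definition H2C2 (w : R -> C * C) : Prop :=
  H2C (fun x => fst (w x)) /\ H2C (fun x => snd (w x)).

(* is_Lop f c tau U w z :  z = L^tau w, where
   L^tau = - B^{-1} (A d/dx + C(x)),  A = [[-c,-1],[-1,-c tau]],
   B = diag(1, tau),  C(x) = diag(-f'(U x), 1). *)
Definition is_Lop (f : R -> R) (c tau : R) (U : R -> R)
    (w : R -> C * C) (z : R -> C * C) : Prop :=
  exists d1 d2 : R -> C,
    (forall x, is_derive (fun y => fst (w y)) x (d1 x)) /\
    (forall x, is_derive (fun y => snd (w y)) x (d2 x)) /\
    (forall x,
      z x =
      ( Copp (Cplus (Cplus (Cmult (RtoC (- c)) (d1 x)) (Cmult (RtoC (-1)) (d2 x)))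
                    (Cmult (RtoC (- Derive f (U x))) (fst (w x)))),
        Cmult (RtoC (- / tau))
              (Cplus (Cplus (Cmult (RtoC (-1)) (d1 x)) (Cmult (RtoC (- c * tau)) (d2 x)))
                     (snd (w x))) )).

(* Main.v *)
(* Put P = (U', V'). If c^2 tau = 1 the profile collapses to a scalar flow that cannot converge
   to its repelling rest points, so c^2 tau <> 1, and both the profile equations (differentiated)
   and the kernel equations of L^tau can be solved for the derivatives: each becomes the same
   linear system y' = M(x) y, with M bounded together with M', and P solves it. Near the rest
   points M(x) is close to a hyperbolic constant matrix, for which a quadratic Lyapunov form
   exists; it makes P square integrable, and y'' = (M' + M^2) y then puts P in H^2.
   Conversely, if y is a square-integrable solution, the Wronskian W = P_1 y_2 - P_2 y_1 obeys
   W' = (tr M) W, and tr M has a fixed sign near one end of the line; there W^2 is monotone yet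
   integrable, so W vanishes somewhere, and uniqueness for the linear system gives y = k P.
   Real and imaginary parts of a complex kernel element are treated separately. *)

Require Import Defs.
From Stdlib Require Import Reals Lra Psatz Classical.
From Coquelicot Require Import Coquelicot.
Open Scope R_scope.

(** * Real analysis on the line *)

Lemma continuous_of_is_derive (h : R -> R) x l : is_derive h x l -> continuous h x.
Proof. intros H. apply (@ex_derive_continuous R_AbsRing R_NormedModule). exists l; exact H. Qed.

Lemma continuity_pt_of_is_derive (h : R -> R) x l : is_derive h x l -> continuity_pt h x.
Proof. intros H. apply continuity_pt_filterlim, (continuous_of_is_derive h x l H). Qed.

Lemma continuous_Rplus (h1 h2 : R -> R) x :
  continuous h1 x -> continuous h2 x -> continuous (fun y => h1 y + h2 y) x.
Proof. apply (@continuous_plus R_UniformSpace R_AbsRing R_NormedModule). Qed.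

Lemma continuous_Rmult (h1 h2 : R -> R) x :
  continuous h1 x -> continuous h2 x -> continuous (fun y => h1 y * h2 y) x.
Proof. apply (@continuous_mult R_UniformSpace R_AbsRing). Qed.

Lemma continuous_sum_sq (y1 y2 : R -> R) x :
  continuous y1 x -> continuous y2 x -> continuous (fun t => y1 t ^ 2 + y2 t ^ 2) x.
Proof.
  intros H1 H2.
  apply continuous_Rplus; apply continuous_Rmult; auto; apply continuous_Rmult;
    auto using continuous_const.
Qed.

Lemma Derive_eq (h : R -> R) x l : is_derive h x l -> Derive (fun y : R => h y) x = l.
Proof. apply is_derive_unique. Qed.

Lemma derive_nonneg_le (h h' : R -> R) a b : a <= b ->
  (forall t, a <= t <= b -> is_derive h t (h' t)) ->
  (forall t, a <= t <= b -> 0 <= h' t) -> h a <= h b.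
Proof.
  intros Hab Hd Hp.
  destruct (MVT_gen h a b h') as [x [Hx E]];
    rewrite ?Rmin_left, ?Rmax_right in * by lra.
  - intros x Hx. apply Hd; lra.
  - intros x Hx. apply (continuity_pt_of_is_derive h x (h' x)), Hd; lra.
  - assert (0 <= h' x) by (apply Hp; lra). nra.
Qed.

Lemma eq_of_derive_zero (h : R -> R) : (forall x, is_derive h x 0) -> forall a b, h a = h b.
Proof.
  intros Hd a b.
  destruct (MVT_gen h a b (fun _ => 0)) as [x [_ E]].
  - intros; apply Hd.
  - intros x _. apply (continuity_pt_of_is_derive h x 0), Hd.
  - lra.
Qed.

Lemma is_lim_p_infty_abs (h : R -> R) (l : R) : is_lim h p_infty l ->
  forall eps, 0 < eps -> exists M, forall x, M < x -> Rabs (h x - l) < eps.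
Proof. intros H eps Heps. apply is_lim_spec in H. exact (H (mkposreal eps Heps)). Qed.

Lemma is_lim_m_infty_abs (h : R -> R) (l : R) : is_lim h m_infty l ->
  forall eps, 0 < eps -> exists M, forall x, x < M -> Rabs (h x - l) < eps.
Proof. intros H eps Heps. apply is_lim_spec in H. exact (H (mkposreal eps Heps)). Qed.

Lemma continuous_abs_near (h : R -> R) s : continuous h s ->
  forall eps, 0 < eps -> exists delta, 0 < delta /\
    forall t, Rabs (t - s) < delta -> Rabs (h t - h s) < eps.
Proof.
  intros Hc eps Heps.
  destruct (proj1 (filterlim_locally h (h s)) Hc (mkposreal eps Heps)) as [d Hd].
  exists d. split; [apply cond_pos | intros t Ht; exact (Hd t Ht)].
Qed.

Definition bounded_fun (h : R -> R) := exists K, forall x, Rabs (h x) <= K.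

Lemma bounded_fun_const k : bounded_fun (fun _ => k).
Proof. exists (Rabs k). intros; lra. Qed.

Lemma bounded_fun_plus h1 h2 :
  bounded_fun h1 -> bounded_fun h2 -> bounded_fun (fun x => h1 x + h2 x).
Proof.
  intros [K1 H1] [K2 H2]. exists (K1 + K2). intros x.
  eapply Rle_trans; [apply Rabs_triang|]. specialize (H1 x). specialize (H2 x). lra.
Qed.

Lemma bounded_fun_mult h1 h2 :
  bounded_fun h1 -> bounded_fun h2 -> bounded_fun (fun x => h1 x * h2 x).
Proof.
  intros [K1 H1] [K2 H2]. exists (K1 * K2). intros x. rewrite Rabs_mult.
  apply Rmult_le_compat; try apply Rabs_pos; auto.
Qed.

Lemma bounded_fun_of_is_lim (h : R -> R) (l1 l2 : R) : (forall x, continuous h x) ->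
  is_lim h m_infty l1 -> is_lim h p_infty l2 -> bounded_fun h.
Proof.
  intros Hc H1 H2.
  destruct (is_lim_m_infty_abs h l1 H1 1 Rlt_0_1) as [M1 HM1].
  destruct (is_lim_p_infty_abs h l2 H2 1 Rlt_0_1) as [M2 HM2].
  destruct (bounded_continuity h M1 M2) as [K HK].
  { intros x _. apply Hc. }
  exists (Rmax K (Rmax (Rabs l1 + 1) (Rabs l2 + 1))). intros x.
  pose proof (Rmax_l K (Rmax (Rabs l1 + 1) (Rabs l2 + 1))).
  pose proof (Rmax_r K (Rmax (Rabs l1 + 1) (Rabs l2 + 1))).
  pose proof (Rmax_l (Rabs l1 + 1) (Rabs l2 + 1)).
  pose proof (Rmax_r (Rabs l1 + 1) (Rabs l2 + 1)).
  destruct (Rlt_dec x M1) as [Hx1|Hx1]; [|destruct (Rlt_dec M2 x) as [Hx2|Hx2]].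
  - specialize (HM1 x Hx1). pose proof (Rabs_triang_inv (h x) l1). lra.
  - specialize (HM2 x Hx2). pose proof (Rabs_triang_inv (h x) l2). lra.
  - specialize (HK x ltac:(lra)). unfold norm in HK; simpl in HK. unfold abs in HK; simpl in HK. lra.
Qed.

Lemma is_lim_lin0 (h k : R -> R) (x : Rbar) al be :
  is_lim h x 0 -> is_lim k x 0 -> is_lim (fun y => al * h y + be * k y) x 0.
Proof.
  intros Hh Hk. replace (Finite 0) with (Finite (al * 0 + be * 0)) by (f_equal; ring).
  apply is_lim_plus'; [apply (is_lim_scal_l h al x 0 Hh) | apply (is_lim_scal_l k be x 0 Hk)].
Qed.

Lemma is_lim_reflect (h : R -> R) (l : R) : is_lim h m_infty l -> is_lim (fun x => h (- x)) p_infty l.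
Proof.
  intros H. apply (is_lim_comp h Ropp p_infty l m_infty H).
  - apply (is_lim_opp (fun y => y) p_infty p_infty), is_lim_id.
  - exists 0. intros y _. discriminate.
Qed.

Lemma eq_of_const_is_lim (h : R -> R) (x : Rbar) (e l : R) :
  (forall y, h y = e) -> is_lim h x l -> e = l.
Proof.
  intros He Hl. apply is_lim_ext with (g := fun _ => e) in Hl; [|exact He].
  pose proof (is_lim_unique _ _ _ Hl) as E1. rewrite (is_lim_unique _ _ _ (is_lim_const e x)) in E1.
  injection E1. auto.
Qed.

Definition RInt_bounded (h : R -> R) :=
  exists B, forall a b, a <= b -> ex_RInt h a b /\ RInt h a b <= B.

Lemma ex_RInt_continuous_R (h : R -> R) a b : (forall x, continuous h x) -> ex_RInt h a b.
Proof. intros Hc. apply (@ex_RInt_continuous R_CompleteNormedModule). intros; apply Hc. Qed.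

Lemma RInt_le_superinterval (h : R -> R) a0 a b b0 :
  a0 <= a -> a <= b -> b <= b0 -> ex_RInt h a0 b0 -> (forall x, 0 <= h x) ->
  ex_RInt h a b /\ RInt h a b <= RInt h a0 b0.
Proof.
  intros H1 H2 H3 Hex Hp.
  assert (E1 : ex_RInt h a0 b) by (apply (ex_RInt_Chasles_1 h a0 b b0); [lra|exact Hex]).
  assert (E2 : ex_RInt h b b0) by (apply (ex_RInt_Chasles_2 h a0 b b0); [lra|exact Hex]).
  assert (E3 : ex_RInt h a0 a) by (apply (ex_RInt_Chasles_1 h a0 a b); [lra|exact E1]).
  assert (E4 : ex_RInt h a b) by (apply (ex_RInt_Chasles_2 h a0 a b); [lra|exact E1]).
  split; [exact E4|].
  rewrite <- (RInt_Chasles h a0 b b0 E1 E2), <- (RInt_Chasles h a0 a b E3 E4).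
  assert (0 <= RInt h a0 a) by (apply RInt_ge_0; auto).
  assert (0 <= RInt h b b0) by (apply RInt_ge_0; auto).
  unfold plus; simpl. lra.
Qed.

Lemma RInt_bounded_of_ex_RInt_gen (h : R -> R) : (forall x, 0 <= h x) ->
  ex_RInt_gen h (Rbar_locally m_infty) (Rbar_locally p_infty) -> RInt_bounded h.
Proof.
  intros Hp [l Hl].
  destruct (Hl (ball l (mkposreal 1 Rlt_0_1)) (locally_ball l _)) as [Q R' [M1 HQ] [M2 HR] Hall].
  exists (l + 1). intros a b Hab.
  pose proof (Rmin_l a (M1 - 1)). pose proof (Rmin_r a (M1 - 1)).
  pose proof (Rmax_l b (M2 + 1)). pose proof (Rmax_r b (M2 + 1)).
  destruct (Hall (Rmin a (M1 - 1)) (Rmax b (M2 + 1))) as [y [Hy Hby]];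
    [apply HQ; lra | apply HR; lra |].
  destruct (RInt_le_superinterval h (Rmin a (M1 - 1)) a b (Rmax b (M2 + 1))) as [E Hle];
    auto; [exists y; exact Hy|].
  split; [exact E|].
  simpl in Hy. rewrite (is_RInt_unique _ _ _ _ Hy) in Hle.
  unfold ball in Hby; simpl in Hby; unfold AbsRing_ball, abs, minus, plus, opp in Hby; simpl in Hby.
  apply Rabs_lt_between in Hby. lra.
Qed.

Lemma ex_RInt_gen_of_RInt_bounded (h : R -> R) :
  (forall x, continuous h x) -> (forall x, 0 <= h x) -> RInt_bounded h ->
  ex_RInt_gen h (Rbar_locally m_infty) (Rbar_locally p_infty).
Proof.
  intros Hc Hp [B HB].
  set (E := fun r => exists a b, a <= b /\ r = RInt h a b).
  assert (HE : bound E) by (exists B; intros r [a [b [Hab ->]]]; apply HB, Hab).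
  assert (HE0 : E (RInt h 0 0)) by (exists 0, 0; split; [lra|reflexivity]).
  destruct (completeness E HE (ex_intro _ _ HE0)) as [L [HLub HLmin]].
  exists L. intros P [eps Heps].
  assert (Hr : exists a0 b0, a0 <= b0 /\ L - eps < RInt h a0 b0).
  { apply NNPP. intros Hno.
    assert (L <= L - eps).
    { apply HLmin. intros r [a [b [Hab ->]]]. apply Rnot_lt_le. intros Hlt.
      apply Hno. exists a, b. auto. }
    destruct eps; simpl in *; lra. }
  destruct Hr as [a0 [b0 [Hab0 Hr]]].
  apply (Filter_prod _ _ _ (fun x => x < a0) (fun y => b0 < y)); [exists a0; auto | exists b0; auto|].
  intros x y Hx Hy. exists (RInt h x y). split.
  - apply (@RInt_correct R_CompleteNormedModule), ex_RInt_continuous_R, Hc.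
  - apply Heps.
    destruct (RInt_le_superinterval h x a0 b0 y) as [_ Hle]; try lra; auto using ex_RInt_continuous_R.
    assert (RInt h x y <= L) by (apply HLub; exists x, y; split; [lra|reflexivity]).
    unfold ball; simpl; unfold AbsRing_ball, abs, minus, plus, opp; simpl.
    apply Rabs_lt_between. destruct eps; simpl in *. lra.
Qed.

Lemma RInt_bounded_le (h1 h2 : R -> R) C : 0 <= C ->
  (forall x, continuous h1 x) -> (forall x, h1 x <= C * h2 x) -> RInt_bounded h2 -> RInt_bounded h1.
Proof.
  intros HC Hc Hle [B HB]. exists (C * B). intros a b Hab.
  destruct (HB a b Hab) as [E2 HB2].
  split; [apply ex_RInt_continuous_R, Hc|].
  apply Rle_trans with (RInt (fun x => C * h2 x) a b).
  - apply RInt_le; auto using ex_RInt_continuous_R.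
    apply (@ex_RInt_scal R_CompleteNormedModule h2 a b C E2).
  - assert (E : RInt (fun x => C * h2 x) a b = C * RInt h2 a b)
      by exact (@RInt_scal R_CompleteNormedModule h2 a b C E2).
    rewrite E.
    apply Rmult_le_compat_l; auto.
Qed.

Lemma RInt_bounded_of_tails (h : R -> R) X1 X2 B1 B2 :
  (forall x, continuous h x) -> (forall x, 0 <= h x) ->
  (forall a b, a <= b -> b <= X1 -> RInt h a b <= B1) ->
  (forall a b, X2 <= a -> a <= b -> RInt h a b <= B2) -> RInt_bounded h.
Proof.
  intros Hc Hp H1 H2.
  exists (B1 + RInt h (Rmin X1 X2) X2 + B2). intros a b Hab.
  split; [apply ex_RInt_continuous_R, Hc|].
  pose proof (Rmin_l X1 X2). pose proof (Rmin_r X1 X2).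
  pose proof (Rmin_l a (Rmin X1 X2)). pose proof (Rmin_r a (Rmin X1 X2)).
  pose proof (Rmax_l b X2). pose proof (Rmax_r b X2).
  destruct (RInt_le_superinterval h (Rmin a (Rmin X1 X2)) a b (Rmax b X2)) as [_ Hle];
    auto using ex_RInt_continuous_R.
  rewrite <- (RInt_Chasles h (Rmin a (Rmin X1 X2)) (Rmin X1 X2) (Rmax b X2)),
    <- (RInt_Chasles h (Rmin X1 X2) X2 (Rmax b X2)) in Hle;
    auto using ex_RInt_continuous_R.
  assert (RInt h (Rmin a (Rmin X1 X2)) (Rmin X1 X2) <= B1) by (apply H1; lra).
  assert (RInt h X2 (Rmax b X2) <= B2) by (apply H2; lra).
  unfold plus in Hle; simpl in Hle. lra.
Qed.

Lemma RInt_le_of_derive (Q Q' g : R -> R) k a b : a <= b -> (forall x, continuous g x) ->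
  (forall t, a <= t <= b -> is_derive Q t (Q' t)) ->
  (forall t, a <= t <= b -> k * g t <= Q' t) -> k * RInt g a b <= Q b - Q a.
Proof.
  intros Hab Hc Hd Hk.
  assert (HG : forall t, is_derive (fun s => RInt g a s) t (g t)).
  { intros t. apply (@is_derive_RInt R_CompleteNormedModule g (RInt g a) a t); [|apply Hc].
    apply filter_forall. intros s.
    apply (@RInt_correct R_CompleteNormedModule), ex_RInt_continuous_R, Hc. }
  assert (H := derive_nonneg_le (fun t => Q t - k * RInt g a t) (fun t => Q' t - k * g t) a b Hab).
  simpl in H. rewrite RInt_point in H. unfold zero in H; simpl in H.
  enough (Q a - k * 0 <= Q b - k * RInt g a b) by lra.
  apply H.
  - intros t Ht. apply (is_derive_minus Q (fun t => k * RInt g a t)); [apply Hd, Ht|].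
    apply (is_derive_scal (fun t => RInt g a t)), HG.
  - intros t Ht. specialize (Hk t Ht). lra.
Qed.

Lemma RInt_bounded_plus (h1 h2 : R -> R) :
  RInt_bounded h1 -> RInt_bounded h2 -> RInt_bounded (fun x => h1 x + h2 x).
Proof.
  intros [B1 H1] [B2 H2]. exists (B1 + B2). intros a b Hab.
  destruct (H1 a b Hab) as [E1 R1]. destruct (H2 a b Hab) as [E2 R2].
  split; [apply (@ex_RInt_plus R_NormedModule); auto|].
  assert (E : RInt (fun x => h1 x + h2 x) a b = RInt h1 a b + RInt h2 a b)
    by exact (@RInt_plus R_CompleteNormedModule _ _ a b E1 E2).
  rewrite E. lra.
Qed.

Lemma RInt_bounded_not_ge (h : R -> R) d : RInt_bounded h -> 0 < d ->
  exists L, 0 <= L /\ forall a, ~ (forall t, a <= t <= a + L -> d <= h t).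
Proof.
  intros [B HB] Hd. exists (Rabs B / d + 1).
  assert (0 <= Rabs B / d) by (apply Rdiv_le_0_compat; [apply Rabs_pos|lra]).
  split; [lra|]. intros a Hge.
  destruct (HB a (a + (Rabs B / d + 1)) ltac:(lra)) as [Hex Hle].
  assert (Hlow : RInt (fun _ => d) a (a + (Rabs B / d + 1)) <= RInt h a (a + (Rabs B / d + 1)))
    by (apply RInt_le; auto; [lra|apply ex_RInt_const|intros; apply Hge; lra]).
  rewrite RInt_const in Hlow. unfold scal in Hlow; simpl in Hlow; unfold mult in Hlow; simpl in Hlow.
  replace ((a + (Rabs B / d + 1) - a) * d) with (Rabs B + d) in Hlow by (field; lra).
  pose proof (Rle_abs B). lra.
Qed.

Lemma RInt_tail_p_of_lyapunov (Q Q' g : R -> R) k X : 0 < k -> (forall x, continuous g x) ->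
  (forall x, 0 <= g x) -> (forall t, is_derive Q t (Q' t)) -> is_lim Q p_infty 0 ->
  (forall t, X <= t -> k * g t <= Q' t) ->
  forall a b, X <= a -> a <= b -> RInt g a b <= - Q X / k.
Proof.
  intros Hk Hc Hg HQ Hl Hd a b Ha Hab.
  assert (Hmono : forall s t, X <= s -> s <= t -> Q s <= Q t).
  { intros s t Hs Hst. apply (derive_nonneg_le Q Q' s t Hst); [intros; apply HQ|].
    intros u Hu. specialize (Hd u ltac:(lra)). specialize (Hg u). nra. }
  assert (Hb : Q b <= 0).
  { apply Rnot_lt_le. intros Hn.
    destruct (is_lim_p_infty_abs Q 0 Hl (Q b) Hn) as [M HM].
    pose proof (Rmax_l b M). pose proof (Rmax_r b M).
    specialize (HM (Rmax b M + 1) ltac:(lra)).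
    rewrite Rminus_0_r in HM. apply Rabs_lt_between in HM.
    assert (Q b <= Q (Rmax b M + 1)) by (apply Hmono; lra).
    lra. }
  assert (Q X <= Q a) by (apply Hmono; lra).
  assert (Hint := RInt_le_of_derive Q Q' g k a b Hab Hc (fun t _ => HQ t)
    (fun t Ht => Hd t ltac:(lra))).
  apply (Rmult_le_reg_l k); [exact Hk|].
  replace (k * (- Q X / k)) with (- Q X) by (field; lra). lra.
Qed.

Lemma RInt_tail_m_of_lyapunov (Q Q' g : R -> R) k X : 0 < k -> (forall x, continuous g x) ->
  (forall x, 0 <= g x) -> (forall t, is_derive Q t (Q' t)) -> is_lim Q m_infty 0 ->
  (forall t, t <= X -> k * g t <= Q' t) ->
  forall a b, a <= b -> b <= X -> RInt g a b <= Q X / k.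
Proof.
  intros Hk Hc Hg HQ Hl Hd a b Hab Hb.
  assert (Hmono : forall s t, t <= X -> s <= t -> Q s <= Q t).
  { intros s t Hs Hst. apply (derive_nonneg_le Q Q' s t Hst); [intros; apply HQ|].
    intros u Hu. specialize (Hd u ltac:(lra)). specialize (Hg u). nra. }
  assert (Ha : 0 <= Q a).
  { apply Rnot_lt_le. intros Hn.
    destruct (is_lim_m_infty_abs Q 0 Hl (- Q a) ltac:(lra)) as [M HM].
    pose proof (Rmin_l a M). pose proof (Rmin_r a M).
    specialize (HM (Rmin a M - 1) ltac:(lra)).
    rewrite Rminus_0_r in HM. apply Rabs_lt_between in HM.
    assert (Q (Rmin a M - 1) <= Q a) by (apply Hmono; lra).
    lra. }
  assert (Q b <= Q X) by (apply Hmono; lra).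
  assert (Hint := RInt_le_of_derive Q Q' g k a b Hab Hc (fun t _ => HQ t)
    (fun t Ht => Hd t ltac:(lra))).
  apply (Rmult_le_reg_l k); [exact Hk|].
  replace (k * (Q X / k)) with (Q X) by (field; lra). lra.
Qed.

Section LyapunovZero.

Variables (D D' : R -> R) (eps : R).
Hypotheses (Heps : 0 < eps) (HD : forall x, is_derive D x (D' x)) (Hpos : forall x, 0 <= D x)
  (Hsmall : forall x, D x < eps -> 0 <= D' x).

Lemma le_of_lyapunov_small a b : a <= b -> (forall t, a <= t <= b -> D t < eps) -> D a <= D b.
Proof.
  intros Hab Ht. apply (derive_nonneg_le D D' a b Hab); [intros; apply HD|].
  intros t Ht'. apply Hsmall, Ht, Ht'.
Qed.

Lemma lyapunov_eventually_zero : is_lim D p_infty 0 -> exists X, forall x, X < x -> D x = 0.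
Proof.
  intros Hl.
  destruct (is_lim_p_infty_abs D 0 Hl eps Heps) as [X HX].
  assert (HX' : forall x, X < x -> D x < eps).
  { intros x Hx. specialize (HX x Hx). rewrite Rminus_0_r in HX. apply Rabs_lt_between in HX. lra. }
  exists X. intros x2 Hx2. apply Rle_antisym; [apply Rnot_lt_le; intros Hx2p|apply Hpos].
  destruct (is_lim_p_infty_abs D 0 Hl (D x2) Hx2p) as [X2 HX2].
  pose proof (Rmax_l x2 X2). pose proof (Rmax_r x2 X2).
  specialize (HX2 (Rmax x2 X2 + 1) ltac:(lra)). rewrite Rminus_0_r in HX2.
  apply Rabs_lt_between in HX2.
  assert (D x2 <= D (Rmax x2 X2 + 1)) by (apply le_of_lyapunov_small; [lra|intros; apply HX'; lra]).
  lra.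
Qed.

(* The last point where [D] is positive would have to be a zero of [D] approached from the left by
   positive values, which is impossible since [D] is nondecreasing where it is small. *)
Lemma lyapunov_zero_of_tail X : (forall x, X < x -> D x = 0) -> forall x, D x = 0.
Proof.
  intros HX x1. apply Rle_antisym; [apply Rnot_lt_le; intros Hx1|apply Hpos].
  assert (Hc : forall x, continuous D x)
    by (intros x; apply (continuous_of_is_derive D x (D' x)), HD).
  set (E := fun x => 0 < D x).
  assert (HE : bound E).
  { exists X. intros x Hx. apply Rnot_lt_le. intros HXx. unfold E in Hx. rewrite HX in Hx; lra. }
  destruct (completeness E HE (ex_intro _ x1 Hx1)) as [s [Hub Hmin]].
  assert (Hs0 : D s = 0).
  { apply Rle_antisym; [apply Rnot_lt_le; intros Hsp|apply Hpos].
    destruct (continuous_abs_near D s (Hc s) (D s) Hsp) as [de [Hde Hde']].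
    assert (E (s + de / 2)).
    { specialize (Hde' (s + de / 2) ltac:(rewrite Rabs_right; lra)).
      apply Rabs_lt_between in Hde'. unfold E. lra. }
    specialize (Hub _ H). lra. }
  destruct (continuous_abs_near D s (Hc s) eps Heps) as [de [Hde Hde']].
  assert (Hex : exists x, E x /\ s - de < x).
  { apply NNPP. intros Hno.
    enough (s <= s - de) by lra.
    apply Hmin. intros x Hx. apply Rnot_lt_le. intros Hlt. apply Hno. exists x. auto. }
  destruct Hex as [x [Hx Hxs]].
  assert (Hxle : x <= s) by (apply Hub, Hx).
  assert (D x <= D s).
  { apply le_of_lyapunov_small; [exact Hxle|]. intros t Ht.
    assert (Rabs (D t - D s) < eps) by (apply Hde', Rabs_lt_between; lra).
    rewrite Hs0, Rminus_0_r in H. apply Rabs_lt_between in H. lra. }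
  unfold E in Hx. lra.
Qed.

End LyapunovZero.

Lemma eq_of_repelling (u u' : R -> R) (e delta : R) : 0 < delta ->
  (forall x, is_derive u x (u' x)) -> is_lim u p_infty e ->
  (forall x, Rabs (u x - e) < delta -> 0 <= (u x - e) * u' x) -> forall x, u x = e.
Proof.
  intros Hdel Hd Hl Hrep.
  set (D := fun x => (u x - e) ^ 2).
  assert (HD : forall x, is_derive D x (2 * (u x - e) * u' x)).
  { intros x. unfold D. auto_derive; [exists (u' x); apply Hd|].
    rewrite (Derive_eq u x _ (Hd x)). ring. }
  assert (Hsmall : forall x, D x < delta ^ 2 -> 0 <= 2 * (u x - e) * u' x).
  { intros x Hx. enough (0 <= (u x - e) * u' x) by lra. apply Hrep.
    unfold D in Hx. rewrite <- pow2_abs in Hx.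
    apply Rnot_le_lt. intros Hge. pose proof (Rabs_pos (u x - e)). nra. }
  assert (HlD : is_lim D p_infty 0).
  { replace (Finite 0) with (Finite ((e - e) ^ 2)) by (f_equal; ring).
    apply (is_lim_comp_continuous u (fun y => (y - e) ^ 2)); [exact Hl|].
    apply (continuous_of_is_derive _ _ (2 * (e - e))). auto_derive; [exact I|ring]. }
  assert (Hdel2 : 0 < delta ^ 2) by nra.
  intros x.
  destruct (lyapunov_eventually_zero D _ _ Hdel2 HD (fun y => pow2_ge_0 _) Hsmall HlD) as [X HX].
  pose proof (lyapunov_zero_of_tail D _ _ Hdel2 HD (fun y => pow2_ge_0 _) Hsmall X HX x) as Hx.
  unfold D in Hx. nra.
Qed.

(** * Quadratic Lyapunov forms of 2x2 matrices *)

Lemma quadratic_abs_le (al be ga p1 p2 : R) :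
  Rabs (al * p1 ^ 2 + be * (p1 * p2) + ga * p2 ^ 2)
  <= (Rabs al + Rabs be + Rabs ga) * (p1 ^ 2 + p2 ^ 2).
Proof.
  pose proof (Rle_abs al). pose proof (Rle_abs be). pose proof (Rle_abs ga).
  pose proof (Rabs_pos al). pose proof (Rabs_pos be). pose proof (Rabs_pos ga).
  pose proof (Rle_abs (- al)). pose proof (Rle_abs (- be)). pose proof (Rle_abs (- ga)).
  rewrite !Rabs_Ropp in *.
  assert (0 <= (Rabs be - be) * (p1 + p2) ^ 2) by (apply Rmult_le_pos; [lra|apply pow2_ge_0]).
  assert (0 <= (Rabs be + be) * (p1 - p2) ^ 2) by (apply Rmult_le_pos; [lra|apply pow2_ge_0]).
  assert (0 <= (Rabs al - al) * p1 ^ 2) by (apply Rmult_le_pos; [lra|apply pow2_ge_0]).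
  assert (0 <= (Rabs al + al) * p1 ^ 2) by (apply Rmult_le_pos; [lra|apply pow2_ge_0]).
  assert (0 <= (Rabs ga - ga) * p2 ^ 2) by (apply Rmult_le_pos; [lra|apply pow2_ge_0]).
  assert (0 <= (Rabs ga + ga) * p2 ^ 2) by (apply Rmult_le_pos; [lra|apply pow2_ge_0]).
  assert (0 <= (Rabs be + be) * (p1 + p2) ^ 2) by (apply Rmult_le_pos; [lra|apply pow2_ge_0]).
  assert (0 <= (Rabs be - be) * (p1 - p2) ^ 2) by (apply Rmult_le_pos; [lra|apply pow2_ge_0]).
  assert (0 <= Rabs al * p2 ^ 2) by (apply Rmult_le_pos; [lra|apply pow2_ge_0]).
  assert (0 <= Rabs ga * p1 ^ 2) by (apply Rmult_le_pos; [lra|apply pow2_ge_0]).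
  apply Rabs_le. split; lra.
Qed.

Definition qform (X Y Z p1 p2 : R) := X * p1 ^ 2 + 2 * Y * p1 * p2 + Z * p2 ^ 2.

(* The derivative of [qform X Y Z] along [p' = A p] for [A = [[a, b], [c, d]]]. *)
Definition qform_deriv (a b c d X Y Z p1 p2 : R) :=
  2 * X * p1 * (a * p1 + b * p2) + 2 * Y * ((a * p1 + b * p2) * p2 + p1 * (c * p1 + d * p2))
  + 2 * Z * p2 * (c * p1 + d * p2).

Definition lyapunov_form (a b c d X Y Z k : R) :=
  0 < k /\ forall p1 p2, k * (p1 ^ 2 + p2 ^ 2) <= qform_deriv a b c d X Y Z p1 p2.

(* The solution of the Lyapunov equation [A^T S + S A = I], which exists when no two eigenvalues
   of [A] add up to 0. *)
Lemma lyapunov_form_of_trace_det a b c d : a + d <> 0 -> a * d - b * c <> 0 ->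
  exists X Y Z, lyapunov_form a b c d X Y Z 1.
Proof.
  intros HT HD.
  set (De := (a + d) * (a * d - b * c)).
  assert (HDe : De <> 0) by (apply Rmult_integral_contrapositive; auto).
  exists (((a + d) * d - c * b + c * c) / (2 * De)), (- (a * c + b * d) / (2 * De)),
    ((a * (a + d) - c * b + b * b) / (2 * De)).
  split; [lra|]. intros p1 p2. apply Req_le.
  unfold qform_deriv, De. field. auto.
Qed.

Lemma lyapunov_form_antidiag b c : 0 < b -> 0 < c -> lyapunov_form 0 b c 0 0 (1 / 2) 0 (Rmin b c).
Proof.
  intros Hb Hc. split; [apply Rmin_pos; auto|]. intros p1 p2.
  pose proof (Rmin_l b c). pose proof (Rmin_r b c).
  pose proof (pow2_ge_0 p1). pose proof (pow2_ge_0 p2).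
  unfold qform_deriv. nra.
Qed.

Lemma lyapunov_form_perturb a b c d a' b' c' d' X Y Z k : lyapunov_form a b c d X Y Z k ->
  exists eps, 0 < eps /\ forall t, Rabs t < eps ->
    lyapunov_form (a + t * a') (b + t * b') (c + t * c') (d + t * d') X Y Z (k / 2).
Proof.
  intros [Hk HA].
  set (K := Rabs (2 * (X * a' + Y * c')) + Rabs (2 * (X * b' + Y * a' + Y * d' + Z * c'))
            + Rabs (2 * (Y * b' + Z * d'))).
  assert (HK : 0 <= K) by (unfold K; pose proof (Rabs_pos (2 * (X * a' + Y * c')));
    pose proof (Rabs_pos (2 * (X * b' + Y * a' + Y * d' + Z * c')));
    pose proof (Rabs_pos (2 * (Y * b' + Z * d'))); lra).
  exists (k / (2 * (K + 1))). split; [apply Rdiv_lt_0_compat; lra|].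
  intros t Ht. split; [lra|]. intros p1 p2.
  assert (Hlin : qform_deriv (a + t * a') (b + t * b') (c + t * c') (d + t * d') X Y Z p1 p2
    = qform_deriv a b c d X Y Z p1 p2 + t * (2 * (X * a' + Y * c') * p1 ^ 2
      + 2 * (X * b' + Y * a' + Y * d' + Z * c') * (p1 * p2) + 2 * (Y * b' + Z * d') * p2 ^ 2))
    by (unfold qform_deriv; ring).
  rewrite Hlin.
  pose proof (quadratic_abs_le (2 * (X * a' + Y * c')) (2 * (X * b' + Y * a' + Y * d' + Z * c'))
    (2 * (Y * b' + Z * d')) p1 p2) as Hq. fold K in Hq.
  apply Rabs_le_between in Hq.
  pose proof (HA p1 p2). pose proof (pow2_ge_0 p1). pose proof (pow2_ge_0 p2).
  assert (Htk : Rabs t * K <= k / 2).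
  { apply Rle_trans with (k / (2 * (K + 1)) * K); [apply Rmult_le_compat_r; lra|].
    apply (Rmult_le_reg_r (2 * (K + 1))); [lra|]. field_simplify; [nra|lra]. }
  pose proof (Rle_abs t). pose proof (Rle_abs (- t)). rewrite Rabs_Ropp in *.
  nra.
Qed.

(** * Linear 2x2 systems *)

Lemma gronwall_zero (p p' : R -> R) K x0 : (forall x, is_derive p x (p' x)) ->
  (forall x, 0 <= p x) -> (forall x, Rabs (p' x) <= K * p x) -> p x0 = 0 -> forall x, p x = 0.
Proof.
  intros Hd Hpos Hb H0 x. apply Rle_antisym; [|apply Hpos].
  assert (Hb' : forall t, - (K * p t) <= p' t <= K * p t) by (intros t; apply Rabs_le_between, Hb).
  destruct (Rle_dec x0 x) as [Hx|Hx].
  - assert (He : - (p x0 * exp (- K * x0)) <= - (p x * exp (- K * x))).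
    { apply (derive_nonneg_le (fun t => - (p t * exp (- K * t)))
        (fun t => - (p' t * exp (- K * t) - K * p t * exp (- K * t)))); [exact Hx| |].
      - intros t _. auto_derive; [exists (p' t); apply Hd|].
        rewrite (Derive_eq p t _ (Hd t)). ring.
      - intros t _. specialize (Hb' t). pose proof (exp_pos (- K * t)). nra. }
    rewrite H0 in He. pose proof (exp_pos (- K * x)). nra.
  - assert (He : p x * exp (K * x) <= p x0 * exp (K * x0)).
    { apply (derive_nonneg_le (fun t => p t * exp (K * t))
        (fun t => p' t * exp (K * t) + K * p t * exp (K * t))); [lra| |].
      - intros t _. auto_derive; [exists (p' t); apply Hd|].
        rewrite (Derive_eq p t _ (Hd t)). ring.
      - intros t _. specialize (Hb' t). pose proof (exp_pos (K * t)). nra. }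
    rewrite H0 in He. pose proof (exp_pos (K * x)). nra.
Qed.

Lemma is_lim_qform (y1 y2 : R -> R) (x : Rbar) X Y Z : is_lim y1 x 0 -> is_lim y2 x 0 ->
  is_lim (fun t => qform X Y Z (y1 t) (y2 t)) x 0.
Proof.
  intros H1 H2.
  assert (Hm : forall h k, is_lim h x 0 -> is_lim k x 0 -> is_lim (fun t => h t * k t) x 0).
  { intros h k Hh Hk. replace (Finite 0) with (Rbar_mult 0 0) by (simpl; f_equal; ring).
    apply is_lim_mult; simpl; auto. }
  apply is_lim_ext with
    (fun t => 1 * (X * (y1 t * y1 t) + 2 * Y * (y1 t * y2 t)) + Z * (y2 t * y2 t));
    [intros t; unfold qform; ring|].
  apply is_lim_lin0; [apply is_lim_lin0|]; auto.
Qed.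

(* [W' = T W] keeps [W^2] monotone on a half-line where [T] has a sign, while [W^2] must have
   small averages there. *)
Lemma wronskian_vanishes (W T h : R -> R) K :
  (forall x, is_derive W x (T x * W x)) -> 0 < K -> (forall x, W x ^ 2 <= K * h x) ->
  RInt_bounded h ->
  (exists X, forall t, X <= t -> 0 <= T t) \/ (exists X, forall t, t <= X -> T t <= 0) ->
  exists x, W x = 0.
Proof.
  intros HW HK Hh HB HT.
  assert (HW2 : forall x, is_derive (fun s => W s ^ 2) x (2 * T x * W x ^ 2)).
  { intros x. auto_derive; [exists (T x * W x); apply HW|].
    rewrite (Derive_eq W x _ (HW x)). ring. }
  destruct HT as [[X HX]|[X HX]]; exists X; apply NNPP; intros Hne;
    assert (Hd : 0 < W X ^ 2 / K) by (apply Rdiv_lt_0_compat; [apply pow2_gt_0|]; assumption);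
    destruct (RInt_bounded_not_ge h _ HB Hd) as [L [HL Hno]].
  - apply (Hno X). intros t Ht.
    assert (W X ^ 2 <= W t ^ 2).
    { apply (derive_nonneg_le _ _ X t ltac:(lra) (fun s _ => HW2 s)).
      intros s Hs. specialize (HX s ltac:(lra)). pose proof (pow2_ge_0 (W s)). nra. }
    specialize (Hh t). apply (Rmult_le_reg_l K); [exact HK|].
    replace (K * (W X ^ 2 / K)) with (W X ^ 2) by (field; lra). lra.
  - apply (Hno (X - L)). intros t Ht.
    assert (- W t ^ 2 <= - W X ^ 2).
    { apply (derive_nonneg_le (fun s => - W s ^ 2) (fun s => - (2 * T s * W s ^ 2)) t X
        ltac:(lra)); [intros s _; apply (is_derive_opp (fun s => W s ^ 2)), HW2|].
      intros s Hs. specialize (HX s ltac:(lra)). pose proof (pow2_ge_0 (W s)). nra. }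
    specialize (Hh t). apply (Rmult_le_reg_l K); [exact HK|].
    replace (K * (W X ^ 2 / K)) with (W X ^ 2) by (field; lra). lra.
Qed.

Definition solves2 (m11 m12 m21 m22 y1 y2 : R -> R) :=
  forall x, is_derive y1 x (m11 x * y1 x + m12 x * y2 x) /\
            is_derive y2 x (m21 x * y1 x + m22 x * y2 x).

Section LinearSystem.

Variables m11 m12 m21 m22 : R -> R.

Lemma solves2_swap y1 y2 : solves2 m11 m12 m21 m22 y1 y2 -> solves2 m22 m21 m12 m11 y2 y1.
Proof.
  intros H x. destruct (H x) as [H1 H2]. split.
  - eapply is_derive_ext; [|rewrite Rplus_comm; exact H2]. reflexivity.
  - eapply is_derive_ext; [|rewrite Rplus_comm; exact H1]. reflexivity.
Qed.

Lemma solves2_continuous y1 y2 : solves2 m11 m12 m21 m22 y1 y2 ->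
  forall x, continuous y1 x /\ continuous y2 x.
Proof.
  intros H x. destruct (H x) as [H1 H2].
  split; eapply continuous_of_is_derive; eassumption.
Qed.

Lemma solves2_sub_scal p1 p2 y1 y2 k :
  solves2 m11 m12 m21 m22 p1 p2 -> solves2 m11 m12 m21 m22 y1 y2 ->
  solves2 m11 m12 m21 m22 (fun x => y1 x - k * p1 x) (fun x => y2 x - k * p2 x).
Proof.
  intros Hp Hy x. destruct (Hp x) as [Hp1 Hp2]. destruct (Hy x) as [Hy1 Hy2].
  split; auto_derive; try (repeat split; eexists; eassumption);
    rewrite ?(Derive_eq _ x _ Hp1), ?(Derive_eq _ x _ Hp2), ?(Derive_eq _ x _ Hy1),
      ?(Derive_eq _ x _ Hy2); ring.
Qed.

Lemma solves2_qform y1 y2 X Y Z : solves2 m11 m12 m21 m22 y1 y2 -> forall x,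
  is_derive (fun t => qform X Y Z (y1 t) (y2 t)) x
    (qform_deriv (m11 x) (m12 x) (m21 x) (m22 x) X Y Z (y1 x) (y2 x)).
Proof.
  intros H x. destruct (H x) as [H1 H2]. unfold qform.
  auto_derive; [repeat split; eexists; eassumption|].
  rewrite (Derive_eq _ x _ H1), (Derive_eq _ x _ H2). unfold qform_deriv. ring.
Qed.

Lemma solves2_eq0 y1 y2 x0 :
  bounded_fun m11 -> bounded_fun m12 -> bounded_fun m21 -> bounded_fun m22 ->
  solves2 m11 m12 m21 m22 y1 y2 -> y1 x0 = 0 -> y2 x0 = 0 -> forall x, y1 x = 0 /\ y2 x = 0.
Proof.
  intros [K11 B11] [K12 B12] [K21 B21] [K22 B22] H Hy1 Hy2.
  assert (Hp : forall x, y1 x ^ 2 + y2 x ^ 2 = 0).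
  { apply (gronwall_zero _
      (fun x => 2 * m11 x * y1 x ^ 2 + 2 * (m12 x + m21 x) * (y1 x * y2 x) + 2 * m22 x * y2 x ^ 2)
      (2 * K11 + 2 * (K12 + K21) + 2 * K22) x0).
    - intros x. destruct (H x) as [H1 H2].
      auto_derive; [repeat split; eexists; eassumption|].
      rewrite (Derive_eq _ x _ H1), (Derive_eq _ x _ H2). ring.
    - intros x. pose proof (pow2_ge_0 (y1 x)). pose proof (pow2_ge_0 (y2 x)). lra.
    - intros x. eapply Rle_trans; [apply quadratic_abs_le|].
      apply Rmult_le_compat_r; [pose proof (pow2_ge_0 (y1 x)); pose proof (pow2_ge_0 (y2 x)); lra|].
      rewrite !Rabs_mult, (Rabs_right 2) by lra.
      pose proof (Rabs_triang (m12 x) (m21 x)).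
      specialize (B11 x). specialize (B12 x). specialize (B21 x). specialize (B22 x). lra.
    - rewrite Hy1, Hy2. ring. }
  intros x. specialize (Hp x).
  pose proof (pow2_ge_0 (y1 x)). pose proof (pow2_ge_0 (y2 x)). split; nra.
Qed.

Lemma solves2_wronskian p1 p2 y1 y2 :
  solves2 m11 m12 m21 m22 p1 p2 -> solves2 m11 m12 m21 m22 y1 y2 -> forall x,
  is_derive (fun t => p1 t * y2 t - p2 t * y1 t) x
    ((m11 x + m22 x) * (p1 x * y2 x - p2 x * y1 x)).
Proof.
  intros Hp Hy x. destruct (Hp x) as [Hp1 Hp2]. destruct (Hy x) as [Hy1 Hy2].
  auto_derive; [repeat split; eexists; eassumption|].
  rewrite (Derive_eq _ x _ Hp1), (Derive_eq _ x _ Hp2), (Derive_eq _ x _ Hy1),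
    (Derive_eq _ x _ Hy2). ring.
Qed.

Lemma solves2_RInt_tail_p y1 y2 X0 X Y Z k : solves2 m11 m12 m21 m22 y1 y2 ->
  (forall x, X0 <= x -> lyapunov_form (m11 x) (m12 x) (m21 x) (m22 x) X Y Z k) ->
  is_lim y1 p_infty 0 -> is_lim y2 p_infty 0 ->
  exists B, forall a b, X0 <= a -> a <= b -> RInt (fun x => y1 x ^ 2 + y2 x ^ 2) a b <= B.
Proof.
  intros Hy HL H1 H2. destruct (HL X0 (Rle_refl _)) as [Hk _].
  exists (- qform X Y Z (y1 X0) (y2 X0) / k).
  apply (RInt_tail_p_of_lyapunov (fun t => qform X Y Z (y1 t) (y2 t))
    (fun t => qform_deriv (m11 t) (m12 t) (m21 t) (m22 t) X Y Z (y1 t) (y2 t))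
    (fun x => y1 x ^ 2 + y2 x ^ 2) k X0 Hk); auto using solves2_qform, is_lim_qform.
  - intros x. destruct (solves2_continuous _ _ Hy x).
    apply continuous_sum_sq; assumption.
  - intros x. pose proof (pow2_ge_0 (y1 x)). pose proof (pow2_ge_0 (y2 x)). lra.
  - intros t Ht. apply HL, Ht.
Qed.

Lemma solves2_RInt_tail_m y1 y2 X0 X Y Z k : solves2 m11 m12 m21 m22 y1 y2 ->
  (forall x, x <= X0 -> lyapunov_form (m11 x) (m12 x) (m21 x) (m22 x) X Y Z k) ->
  is_lim y1 m_infty 0 -> is_lim y2 m_infty 0 ->
  exists B, forall a b, a <= b -> b <= X0 -> RInt (fun x => y1 x ^ 2 + y2 x ^ 2) a b <= B.
Proof.
  intros Hy HL H1 H2. destruct (HL X0 (Rle_refl _)) as [Hk _].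
  exists (qform X Y Z (y1 X0) (y2 X0) / k).
  apply (RInt_tail_m_of_lyapunov (fun t => qform X Y Z (y1 t) (y2 t))
    (fun t => qform_deriv (m11 t) (m12 t) (m21 t) (m22 t) X Y Z (y1 t) (y2 t))
    (fun x => y1 x ^ 2 + y2 x ^ 2) k X0 Hk); auto using solves2_qform, is_lim_qform.
  - intros x. destruct (solves2_continuous _ _ Hy x).
    apply continuous_sum_sq; assumption.
  - intros x. pose proof (pow2_ge_0 (y1 x)). pose proof (pow2_ge_0 (y2 x)). lra.
  - intros t Ht. apply HL, Ht.
Qed.

(* Two solutions with vanishing Wronskian at one point are proportional there, hence everywhere. *)
Lemma solves2_proportional p1 p2 y1 y2 h :
  bounded_fun m11 -> bounded_fun m12 -> bounded_fun m21 -> bounded_fun m22 ->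
  solves2 m11 m12 m21 m22 p1 p2 -> solves2 m11 m12 m21 m22 y1 y2 ->
  bounded_fun p1 -> bounded_fun p2 -> (exists x0, p1 x0 <> 0 \/ p2 x0 <> 0) ->
  (exists X, forall t, X <= t -> 0 <= m11 t + m22 t) \/
  (exists X, forall t, t <= X -> m11 t + m22 t <= 0) ->
  (forall x, y1 x ^ 2 + y2 x ^ 2 <= h x) -> RInt_bounded h ->
  exists k, forall x, y1 x = k * p1 x /\ y2 x = k * p2 x.
Proof.
  intros B11 B12 B21 B22 Hp Hy [K1 HK1] [K2 HK2] [x0 Hx0] HT Hh HB.
  assert (Hnz : forall x, p1 x <> 0 \/ p2 x <> 0).
  { intros x. destruct (Req_dec (p1 x) 0) as [Z1|]; [|left; auto].
    destruct (Req_dec (p2 x) 0) as [Z2|]; [|right; auto].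
    destruct (solves2_eq0 p1 p2 x B11 B12 B21 B22 Hp Z1 Z2 x0). tauto. }
  destruct (wronskian_vanishes (fun t => p1 t * y2 t - p2 t * y1 t) (fun t => m11 t + m22 t) h
    (K1 ^ 2 + K2 ^ 2 + 1) (solves2_wronskian _ _ _ _ Hp Hy)) as [x1 Hx1]; auto.
  { pose proof (pow2_ge_0 K1). pose proof (pow2_ge_0 K2). lra. }
  { intros x. specialize (HK1 x). specialize (HK2 x). specialize (Hh x).
    assert (p1 x ^ 2 <= K1 ^ 2) by (rewrite <- (pow2_abs (p1 x)); pose proof (Rabs_pos (p1 x)); nra).
    assert (p2 x ^ 2 <= K2 ^ 2) by (rewrite <- (pow2_abs (p2 x)); pose proof (Rabs_pos (p2 x)); nra).
    pose proof (pow2_ge_0 (p1 x * y1 x + p2 x * y2 x)).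
    pose proof (pow2_ge_0 (y1 x)). pose proof (pow2_ge_0 (y2 x)).
    pose proof (pow2_ge_0 (p1 x)). pose proof (pow2_ge_0 (p2 x)). nra. }
  simpl in Hx1.
  assert (Hk : exists k, y1 x1 = k * p1 x1 /\ y2 x1 = k * p2 x1).
  { destruct (Hnz x1) as [Hn|Hn].
    - exists (y1 x1 / p1 x1). split; [field; exact Hn|].
      apply (Rmult_eq_reg_l (p1 x1)); [|exact Hn].
      replace (p1 x1 * (y1 x1 / p1 x1 * p2 x1)) with (p2 x1 * y1 x1) by (field; exact Hn). lra.
    - exists (y2 x1 / p2 x1). split; [|field; exact Hn].
      apply (Rmult_eq_reg_l (p2 x1)); [|exact Hn].
      replace (p2 x1 * (y2 x1 / p2 x1 * p1 x1)) with (p1 x1 * y2 x1) by (field; exact Hn). lra. }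
  destruct Hk as [k [Hk1 Hk2]]. exists k. intros x.
  destruct (solves2_eq0 _ _ x1 B11 B12 B21 B22 (solves2_sub_scal _ _ _ _ k Hp Hy))
    with (x := x); simpl; lra.
Qed.

End LinearSystem.




(** * Complex-valued functions and H^2 *)

Lemma Cmod_sq (z : C) : Cmod z ^ 2 = fst z ^ 2 + snd z ^ 2.
Proof.
  unfold Cmod. rewrite pow2_sqrt; [reflexivity|].
  pose proof (pow2_ge_0 (fst z)). pose proof (pow2_ge_0 (snd z)). lra.
Qed.

Lemma is_derive_fst_C (h : R -> C) x (l : C) :
  is_derive h x l -> is_derive (fun t => fst (h t)) x (fst l).
Proof.
  intros H. apply (filterdiff_comp' h (fun t : C => fst t) x _ (fun t : C => fst t) H).
  apply filterdiff_linear, is_linear_fst.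
Qed.

Lemma is_derive_snd_C (h : R -> C) x (l : C) :
  is_derive h x l -> is_derive (fun t => snd (h t)) x (snd l).
Proof.
  intros H. apply (filterdiff_comp' h (fun t : C => snd t) x _ (fun t : C => snd t) H).
  apply filterdiff_linear, is_linear_snd.
Qed.

Lemma is_derive_RtoC (h : R -> R) x l : is_derive h x l -> is_derive (fun t => RtoC (h t)) x (RtoC l).
Proof.
  intros H. unfold RtoC.
  apply (filterdiff_comp'_2 h (fun _ => 0) (fun u v => (u, v) : C) x _ _ (fun u v => (u, v) : C) H
    (@is_derive_const R_AbsRing R_NormedModule 0 x)).
  apply filterdiff_linear. split.
  - intros [] []. reflexivity.
  - intros k []. reflexivity.
  - exists 1. split; [lra|]. intros []. rewrite Rmult_1_l. apply Rle_refl.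
Qed.

Lemma continuous_RtoC (h : R -> R) x : continuous h x -> continuous (fun t => RtoC (h t)) x.
Proof.
  intros H. apply filterlim_locally. intros eps.
  generalize (proj1 (filterlim_locally _ _) H eps). apply filter_imp.
  intros t Ht. split; [exact Ht|apply ball_center].
Qed.

Lemma L2C_RtoC_of_lin_comb (h al be y1 y2 : R -> R) : (forall x, continuous h x) ->
  bounded_fun al -> bounded_fun be -> (forall x, h x = al x * y1 x + be x * y2 x) ->
  RInt_bounded (fun x => y1 x ^ 2 + y2 x ^ 2) -> L2C (fun x => RtoC (h x)).
Proof.
  intros Hc [K1 H1] [K2 H2] He HB.
  assert (Hc2 : forall x, continuous (fun x => h x ^ 2) x).
  { intros x. apply continuous_Rmult, continuous_Rmult; auto using continuous_const. }
  assert (Hle : forall x, h x ^ 2 <= 2 * (K1 ^ 2 + K2 ^ 2) * (y1 x ^ 2 + y2 x ^ 2)).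
  { intros x. rewrite He. specialize (H1 x). specialize (H2 x).
    assert (al x ^ 2 <= K1 ^ 2) by (rewrite <- (pow2_abs (al x)); pose proof (Rabs_pos (al x)); nra).
    assert (be x ^ 2 <= K2 ^ 2) by (rewrite <- (pow2_abs (be x)); pose proof (Rabs_pos (be x)); nra).
    pose proof (pow2_ge_0 (y1 x)). pose proof (pow2_ge_0 (y2 x)).
    pose proof (pow2_ge_0 (al x * y1 x - be x * y2 x)). nra. }
  unfold L2C. apply (ex_RInt_gen_ext_eq (fun x => h x ^ 2)).
  { intros x. rewrite Cmod_sq. simpl. ring. }
  apply ex_RInt_gen_of_RInt_bounded; auto using pow2_ge_0.
  apply (RInt_bounded_le _ (fun x => y1 x ^ 2 + y2 x ^ 2) (2 * (K1 ^ 2 + K2 ^ 2))); auto.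
  pose proof (pow2_ge_0 K1). pose proof (pow2_ge_0 K2). lra.
Qed.

Definition C1_bounded (m : R -> R) :=
  exists dm : R -> R, (forall x, is_derive m x (dm x)) /\ (forall x, continuous dm x) /\
    bounded_fun m /\ bounded_fun dm.

Lemma C1_bounded_const k : C1_bounded (fun _ => k).
Proof.
  exists (fun _ => 0). split; [intros; apply (@is_derive_const R_AbsRing R_NormedModule)|].
  split; [intros; apply continuous_const|]. split; apply bounded_fun_const.
Qed.

Lemma C1_bounded_scal k m : C1_bounded m -> C1_bounded (fun x => k * m x).
Proof.
  intros [dm [D [Cd [B B']]]]. exists (fun x => k * dm x).
  split; [intros x; apply (is_derive_scal m x k), D|].
  split; [intros x; apply continuous_Rmult; auto using continuous_const|].
  split; apply bounded_fun_mult; auto using bounded_fun_const.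
Qed.

Lemma C1_bounded_bounded m : C1_bounded m -> bounded_fun m.
Proof. intros [dm [_ [_ [H _]]]]. exact H. Qed.

(* [y'] and [y''] are combinations of [y] with bounded coefficients. *)
Lemma H2C_of_solves2 m11 m12 m21 m22 y1 y2 :
  C1_bounded m11 -> C1_bounded m12 -> C1_bounded m21 -> C1_bounded m22 ->
  solves2 m11 m12 m21 m22 y1 y2 -> RInt_bounded (fun x => y1 x ^ 2 + y2 x ^ 2) ->
  H2C (fun x => RtoC (y1 x)).
Proof.
  intros [d11 [D11 [C11 [B11 B11']]]] [d12 [D12 [C12 [B12 B12']]]] [d21 [D21 [_ [B21 _]]]]
    [d22 [D22 [_ [B22 _]]]] Hy HB.
  assert (Cy : forall x, continuous y1 x /\ continuous y2 x) by (apply solves2_continuous with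
    m11 m12 m21 m22; exact Hy).
  set (z1 := fun x => m11 x * y1 x + m12 x * y2 x).
  set (z2 := fun x => m21 x * y1 x + m22 x * y2 x).
  set (w := fun x => d11 x * y1 x + m11 x * z1 x + d12 x * y2 x + m12 x * z2 x).
  assert (Dz1 : forall x, is_derive z1 x (w x)).
  { intros x. destruct (Hy x) as [H1 H2]. unfold z1, w, z2.
    auto_derive; [repeat split; eexists; eauto|].
    rewrite (Derive_eq _ x _ (D11 x)), (Derive_eq _ x _ (D12 x)), (Derive_eq _ x _ H1),
      (Derive_eq _ x _ H2). unfold z1. ring. }
  assert (Cw : forall x, continuous w x).
  { intros x. destruct (Cy x) as [Cy1 Cy2].
    pose proof (continuous_of_is_derive _ _ _ (D11 x)).
    pose proof (continuous_of_is_derive _ _ _ (D12 x)).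
    pose proof (continuous_of_is_derive _ _ _ (D21 x)).
    pose proof (continuous_of_is_derive _ _ _ (D22 x)).
    unfold w, z1, z2.
    repeat match goal with
      | |- continuous (fun _ => _ + _) _ => apply continuous_Rplus
      | |- continuous (fun _ => _ * _) _ => apply continuous_Rmult
      | _ => first [assumption | apply C11 | apply C12]
      end. }
  exists (fun x => RtoC (z1 x)), (fun x => RtoC (w x)).
  split; [intros x; apply is_derive_RtoC, Hy|].
  split; [intros x; apply is_derive_RtoC, Dz1|].
  split; [intros x; apply continuous_RtoC, Cw|].
  split; [|split].
  - apply (L2C_RtoC_of_lin_comb _ (fun _ => 1) (fun _ => 0) y1 y2); auto using bounded_fun_const.
    + intros x. exact (proj1 (Cy x)).
    + intros x. ring.
  - apply (L2C_RtoC_of_lin_comb z1 m11 m12 y1 y2); auto.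
    intros x. apply (continuous_of_is_derive _ _ _ (Dz1 x)).
  - apply (L2C_RtoC_of_lin_comb _ (fun x => d11 x + m11 x * m11 x + m12 x * m21 x)
      (fun x => d12 x + m11 x * m12 x + m12 x * m22 x) y1 y2); auto.
    + repeat apply bounded_fun_plus; auto; apply bounded_fun_mult; auto.
    + repeat apply bounded_fun_plus; auto; apply bounded_fun_mult; auto.
    + intros x. unfold w, z1, z2. ring.
Qed.

(** * The traveling wave *)

Section TravelingWave.

Variables (f : R -> R) (tau c : R) (U V : R -> R).
Hypotheses (Hsmooth : smooth f) (Hbist : bistable f) (Htau : 0 < tau)
  (Hwave : traveling_wave f tau c U V).

Lemma f_is_derive u : is_derive f u (Derive f u).
Proof. apply Derive_correct, (Hsmooth 1%nat). Qed.

Lemma Df_is_derive u : is_derive (Derive f) u (Derive (Derive f) u).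
Proof. apply Derive_correct, (Hsmooth 2%nat). Qed.

Lemma D2f_is_derive u : is_derive (Derive (Derive f)) u (Derive (Derive (Derive f)) u).
Proof. apply Derive_correct, (Hsmooth 3%nat). Qed.

Lemma U_is_derive x : is_derive U x (Derive U x).
Proof. apply Derive_correct, Hwave. Qed.

Lemma V_is_derive x : is_derive V x (Derive V x).
Proof. apply Derive_correct, Hwave. Qed.

Lemma bistable_near_one : exists delta, 0 < delta /\ forall u, Rabs (u - 1) < delta ->
  Derive f u < 0 /\ (u - 1) * f u <= 0.
Proof.
  destruct Hbist as [al [Hal [_ [_ [Hf1 [_ [Hd1 [_ [_ [Sa1 [_ S1]]]]]]]]]]].
  destruct (continuous_abs_near (Derive f) 1 (continuous_of_is_derive _ _ _ (Df_is_derive 1))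
    (- Derive f 1) ltac:(lra)) as [de [Hde Hnear]].
  exists (Rmin de (1 - al)). split; [apply Rmin_pos; lra|]. intros u Hu.
  pose proof (Rmin_l de (1 - al)). pose proof (Rmin_r de (1 - al)).
  specialize (Hnear u ltac:(lra)). apply Rabs_lt_between in Hnear, Hu.
  split; [lra|].
  destruct (Rtotal_order u 1) as [Hlt|[->|Hgt]].
  - assert (0 < f u) by (apply Sa1; lra). nra.
  - rewrite Hf1. lra.
  - assert (f u < 0) by (apply S1; lra). nra.
Qed.

Lemma bistable_near_zero : exists delta, 0 < delta /\ forall u, Rabs u < delta ->
  Derive f u < 0 /\ u * f u <= 0.
Proof.
  destruct Hbist as [al [Hal [Hf0 [_ [_ [Hd0 [_ [_ [Sneg [_ [S0a _]]]]]]]]]]].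
  destruct (continuous_abs_near (Derive f) 0 (continuous_of_is_derive _ _ _ (Df_is_derive 0))
    (- Derive f 0) ltac:(lra)) as [de [Hde Hnear]].
  exists (Rmin de al). split; [apply Rmin_pos; lra|]. intros u Hu.
  pose proof (Rmin_l de al). pose proof (Rmin_r de al).
  specialize (Hnear u ltac:(rewrite Rminus_0_r; lra)). apply Rabs_lt_between in Hnear, Hu.
  split; [lra|].
  destruct (Rtotal_order u 0) as [Hlt|[->|Hgt]].
  - assert (0 < f u) by (apply Sneg; lra). nra.
  - rewrite Hf0. lra.
  - assert (f u < 0) by (apply S0a; lra). nra.
Qed.

(* For [c^2 tau = 1] the two profile equations combine into [f(U) + c V = 0], which makes the
   profile a scalar flow whose rest points repel on the side where [U] would have to reach them. *)
Lemma degenerate_speed_profile : c * c * tau = 1 ->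
  c <> 0 /\ forall x, Derive U x * (1 - tau * Derive f (U x)) = - c * tau * f (U x).
Proof.
  intros Hcc. assert (Hc : c <> 0) by (intros ->; lra). split; [exact Hc|].
  destruct Hwave as [_ [E1 [E2 _]]].
  assert (HV : forall x, V x = - f (U x) / c).
  { intros x. specialize (E1 x). specialize (E2 x).
    apply (Rmult_eq_reg_l c); [|exact Hc].
    replace (c * (- f (U x) / c)) with (- f (U x)) by (field; exact Hc).
    replace (V x) with (Derive U x + c * tau * Derive V x) by lra.
    replace (c * (Derive U x + c * tau * Derive V x)) with (c * Derive U x + c * c * tau * Derive V x)
      by ring.
    rewrite Hcc. lra. }
  assert (HdV : forall x, Derive V x = - (Derive f (U x) * Derive U x) / c).
  { intros x. rewrite (Derive_ext V (fun x => - f (U x) / c) x HV).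
    apply is_derive_unique. auto_derive.
    - repeat split; eexists; [apply f_is_derive|apply U_is_derive].
    - rewrite (Derive_eq U x _ (U_is_derive x)). change (fun y : R => f y) with f. field. exact Hc. }
  intros x. specialize (E1 x). rewrite HdV in E1.
  assert (E : c * c * tau * Derive U x - tau * Derive f (U x) * Derive U x + c * tau * f (U x) = 0).
  { rewrite <- (Rmult_0_r (c * tau)), <- E1. field. exact Hc. }
  rewrite Hcc in E. lra.
Qed.

Lemma speed_dd_neq0 : c * c * tau - 1 <> 0.
Proof.
  intros Hd. destruct (degenerate_speed_profile ltac:(lra)) as [Hc Key].
  destruct Hwave as [_ [_ [_ [HUm [_ [HUp _]]]]]].
  destruct (Rlt_dec 0 c) as [Hcp|Hcn].
  - destruct bistable_near_one as [de [Hde Hnear]].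
    assert (H1 : forall x, U x = 1).
    { apply (eq_of_repelling U (Derive U) 1 de Hde U_is_derive HUp). intros x Hx.
      destruct (Hnear _ Hx) as [Hg Hs].
      apply (Rmult_le_reg_r (1 - tau * Derive f (U x))); [nra|].
      replace ((U x - 1) * Derive U x * (1 - tau * Derive f (U x)))
        with ((U x - 1) * (Derive U x * (1 - tau * Derive f (U x)))) by ring.
      rewrite Key. nra. }
    pose proof (eq_of_const_is_lim U m_infty 1 0 H1 HUm). lra.
  - destruct bistable_near_zero as [de [Hde Hnear]].
    assert (H0 : forall x, U (- x) = 0).
    { apply (eq_of_repelling (fun x => U (- x)) (fun x => - Derive U (- x)) 0 de Hde);
        [| apply is_lim_reflect, HUm |].
      - intros x. auto_derive; [exists (Derive U (- x)); apply U_is_derive|].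
        rewrite (Derive_eq U (- x) _ (U_is_derive (- x))). ring.
      - intros x Hx. rewrite Rminus_0_r in *.
        destruct (Hnear _ Hx) as [Hg Hs].
        apply (Rmult_le_reg_r (1 - tau * Derive f (U (- x)))); [nra|].
        replace (U (- x) * - Derive U (- x) * (1 - tau * Derive f (U (- x))))
          with (- (U (- x) * (Derive U (- x) * (1 - tau * Derive f (U (- x)))))) by ring.
        rewrite Key. nra. }
    assert (H0' : forall x, U x = 0) by (intros x; rewrite <- (Ropp_involutive x); apply H0).
    pose proof (eq_of_const_is_lim U p_infty 0 1 H0' HUp). lra.
Qed.

Definition dd := c * c * tau - 1.
Definition m11 (ga : R) := (- c * tau / dd) * ga.
Definition m12 := - 1 / dd.
Definition m21 (ga : R) := (1 / dd) * ga.
Definition m22 := c / dd.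
Definition gU (x : R) := Derive f (U x).

(* Both the profile equations and the kernel equations of [L^tau] take the form [y' = M(x) y],
   with [M(x) = [[m11 (gU x), m12], [m21 (gU x), m22]]], once solved for the derivatives. *)
Definition linearized_system : (R -> R) -> (R -> R) -> Prop :=
  solves2 (fun x => m11 (gU x)) (fun _ => m12) (fun x => m21 (gU x)) (fun _ => m22).

Lemma profile_solve s w a b : c * a + b + s = 0 -> a + c * tau * b - w = 0 ->
  a = - (c * tau * s + w) / dd /\ b = (s + c * w) / dd.
Proof.
  intros E1 E2. pose proof speed_dd_neq0 as Hd. fold dd in Hd.
  assert (Ha : a * dd = - (c * tau * s + w)) by (unfold dd; nra).
  split; apply (Rmult_eq_reg_r dd); auto.
  - rewrite Ha. field. exact Hd.
  - replace (b * dd) with (- c * (a * dd) - s * dd) by (replace b with (- c * a - s) by lra; ring).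
    rewrite Ha. field_simplify; [|exact Hd]. unfold dd. ring.
Qed.

Lemma derive_U_formula x : Derive U x = - (c * tau * f (U x) + V x) / dd.
Proof. destruct Hwave as [_ [E1 [E2 _]]]. exact (proj1 (profile_solve _ _ _ _ (E1 x) (E2 x))). Qed.

Lemma derive_V_formula x : Derive V x = (f (U x) + c * V x) / dd.
Proof. destruct Hwave as [_ [E1 [E2 _]]]. exact (proj2 (profile_solve _ _ _ _ (E1 x) (E2 x))). Qed.

Lemma profile_derivatives_solve : linearized_system (Derive U) (Derive V).
Proof.
  pose proof speed_dd_neq0 as Hd. fold dd in Hd.
  intros x. split.
  - apply (is_derive_ext (fun x => - (c * tau * f (U x) + V x) / dd));
      [intros; symmetry; apply derive_U_formula|].
    auto_derive; [repeat split; eexists; eauto using f_is_derive, U_is_derive, V_is_derive|].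
    rewrite (Derive_eq U x _ (U_is_derive x)), (Derive_eq V x _ (V_is_derive x)).
    change (fun y : R => f y) with f. unfold m11, m12, gU. field. exact Hd.
  - apply (is_derive_ext (fun x => (f (U x) + c * V x) / dd));
      [intros; symmetry; apply derive_V_formula|].
    auto_derive; [repeat split; eexists; eauto using f_is_derive, U_is_derive, V_is_derive|].
    rewrite (Derive_eq U x _ (U_is_derive x)), (Derive_eq V x _ (V_is_derive x)).
    change (fun y : R => f y) with f. unfold m21, m22, gU. field. exact Hd.
Qed.

Lemma is_lim_comp_U (h : R -> R) : (forall u, continuous h u) ->
  is_lim (fun x => h (U x)) m_infty (h 0) /\ is_lim (fun x => h (U x)) p_infty (h 1).
Proof.
  destruct Hwave as [_ [_ [_ [HUm [_ [HUp _]]]]]].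
  split; apply is_lim_comp_continuous; auto.
Qed.

Lemma derivatives_vanish_at_infty :
  is_lim (Derive U) m_infty 0 /\ is_lim (Derive U) p_infty 0 /\
  is_lim (Derive V) m_infty 0 /\ is_lim (Derive V) p_infty 0.
Proof.
  destruct Hbist as [al [_ [Hf0 [_ [Hf1 _]]]]].
  destruct Hwave as [_ [_ [_ [_ [HVm [_ HVp]]]]]].
  destruct (is_lim_comp_U f (fun u => continuous_of_is_derive _ _ _ (f_is_derive u))) as [Hm Hp].
  rewrite Hf0 in Hm. rewrite Hf1 in Hp.
  repeat split; [apply (is_lim_ext (fun x => (- c * tau / dd) * f (U x) + (- 1 / dd) * V x))
    | apply (is_lim_ext (fun x => (- c * tau / dd) * f (U x) + (- 1 / dd) * V x))
    | apply (is_lim_ext (fun x => (1 / dd) * f (U x) + (c / dd) * V x))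
    | apply (is_lim_ext (fun x => (1 / dd) * f (U x) + (c / dd) * V x))];
    auto using is_lim_lin0; intros x;
    rewrite ?derive_U_formula, ?derive_V_formula; field; exact speed_dd_neq0.
Qed.

Lemma derivatives_continuous x : continuous (Derive U) x /\ continuous (Derive V) x.
Proof. exact (solves2_continuous _ _ _ _ _ _ profile_derivatives_solve x). Qed.

Lemma derivatives_bounded : bounded_fun (Derive U) /\ bounded_fun (Derive V).
Proof.
  destruct derivatives_vanish_at_infty as [H1 [H2 [H3 H4]]].
  split; [apply (bounded_fun_of_is_lim _ 0 0 (fun x => proj1 (derivatives_continuous x)) H1 H2)
         | apply (bounded_fun_of_is_lim _ 0 0 (fun x => proj2 (derivatives_continuous x)) H3 H4)].
Qed.

Lemma bounded_fun_comp_U (h : R -> R) : (forall u, continuous h u) -> bounded_fun (fun x => h (U x)).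
Proof.
  intros Hc. destruct (is_lim_comp_U h Hc) as [Hm Hp].
  apply (bounded_fun_of_is_lim _ _ _ (fun x => continuous_comp U h x
    (continuous_of_is_derive _ _ _ (U_is_derive x)) (Hc (U x))) Hm Hp).
Qed.

Lemma gU_C1_bounded : C1_bounded gU.
Proof.
  assert (Hc2 : forall u, continuous (Derive (Derive f)) u)
    by (intros u; apply (continuous_of_is_derive _ _ _ (D2f_is_derive u))).
  exists (fun x => Derive (Derive f) (U x) * Derive U x). split; [|split; [|split]].
  - intros x. unfold gU. rewrite Rmult_comm.
    apply (is_derive_comp (Derive f) U x); [apply Df_is_derive|apply U_is_derive].
  - intros x. apply continuous_Rmult; [|apply (proj1 (derivatives_continuous x))].
    apply (continuous_comp U (Derive (Derive f)) x);
      [apply (continuous_of_is_derive _ _ _ (U_is_derive x)) | apply Hc2].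
  - apply bounded_fun_comp_U. intros u. apply (continuous_of_is_derive _ _ _ (Df_is_derive u)).
  - apply bounded_fun_mult; [apply bounded_fun_comp_U, Hc2|apply (proj1 derivatives_bounded)].
Qed.

Lemma coefficients_C1_bounded :
  C1_bounded (fun x => m11 (gU x)) /\ C1_bounded (fun _ => m12) /\
  C1_bounded (fun x => m21 (gU x)) /\ C1_bounded (fun _ => m22).
Proof.
  unfold m11, m21.
  split; [apply C1_bounded_scal, gU_C1_bounded|]. split; [apply C1_bounded_const|].
  split; [apply C1_bounded_scal, gU_C1_bounded|apply C1_bounded_const].
Qed.

Lemma coefficients_bounded :
  bounded_fun (fun x => m11 (gU x)) /\ bounded_fun (fun _ => m12) /\
  bounded_fun (fun x => m21 (gU x)) /\ bounded_fun (fun _ => m22).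
Proof.
  destruct coefficients_C1_bounded as [H1 [H2 [H3 H4]]].
  split; [|split; [|split]]; apply C1_bounded_bounded; assumption.
Qed.

Lemma gU_limits : is_lim gU m_infty (Derive f 0) /\ is_lim gU p_infty (Derive f 1).
Proof. exact (is_lim_comp_U _ (fun u => continuous_of_is_derive _ _ _ (Df_is_derive u))). Qed.

(* The trace [c (1 - tau f'(U)) / dd] has the sign of [c / dd] near both rest points. *)
Lemma trace_eventually_signed :
  (exists X, forall t, X <= t -> 0 <= m11 (gU t) + m22) \/
  (exists X, forall t, t <= X -> m11 (gU t) + m22 <= 0).
Proof.
  assert (HT : forall t, m11 (gU t) + m22 = c / dd * (1 - tau * gU t))
    by (intros t; unfold m11, m22; field; exact speed_dd_neq0).
  destruct Hbist as [al [_ [_ [_ [_ [Hd0 [Hd1 _]]]]]]].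
  destruct gU_limits as [Hg0 Hg1].
  destruct (Rle_dec 0 (c / dd)) as [Hs|Hs].
  - left. destruct (is_lim_p_infty_abs _ _ Hg1 (- Derive f 1) ltac:(lra)) as [M HM].
    exists (M + 1). intros t Ht. specialize (HM t ltac:(lra)). apply Rabs_lt_between in HM.
    rewrite HT. apply Rmult_le_pos; [exact Hs|nra].
  - right. destruct (is_lim_m_infty_abs _ _ Hg0 (- Derive f 0) ltac:(lra)) as [M HM].
    exists (M - 1). intros t Ht. specialize (HM t ltac:(lra)). apply Rabs_lt_between in HM.
    rewrite HT. assert (0 <= 1 - tau * gU t) by nra. nra.
Qed.

Lemma lyapunov_form_near_rest ga0 : ga0 < 0 -> exists X Y Z k eps, 0 < eps /\
  forall ga, Rabs (ga - ga0) < eps -> lyapunov_form (m11 ga) m12 (m21 ga) m22 X Y Z k.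
Proof.
  intros Hga. pose proof speed_dd_neq0 as Hd. fold dd in Hd.
  assert (HA : exists X Y Z k, lyapunov_form (m11 ga0) m12 (m21 ga0) m22 X Y Z k).
  { destruct (Req_dec c 0) as [Hc|Hc].
    - exists 0, (1 / 2), 0, (Rmin 1 (- ga0)).
      replace (m11 ga0) with 0 by (unfold m11; rewrite Hc; field; exact Hd).
      replace m12 with 1 by (unfold m12, dd; rewrite Hc; field).
      replace (m21 ga0) with (- ga0) by (unfold m21, dd; rewrite Hc; field).
      replace m22 with 0 by (unfold m22; rewrite Hc; field; exact Hd).
      apply lyapunov_form_antidiag; lra.
    - assert (Htr : m11 ga0 + m22 = c * (1 - tau * ga0) * / dd)
        by (unfold m11, m22; field; exact Hd).
      assert (Hdet : m11 ga0 * m22 - m12 * m21 ga0 = - ga0 * / dd)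
        by (unfold m11, m12, m21, m22, dd in *; field; exact Hd).
      assert (Hdi : / dd <> 0) by (apply Rinv_neq_0_compat, Hd).
      destruct (lyapunov_form_of_trace_det (m11 ga0) m12 (m21 ga0) m22) as [X [Y [Z HL]]].
      + rewrite Htr. repeat apply Rmult_integral_contrapositive_currified; auto; nra.
      + rewrite Hdet. apply Rmult_integral_contrapositive_currified; auto; lra.
      + exists X, Y, Z, 1. exact HL. }
  destruct HA as [X [Y [Z [k HL]]]].
  destruct (lyapunov_form_perturb _ _ _ _ (- c * tau / dd) 0 (1 / dd) 0 _ _ _ _ HL) as [eps [He H]].
  exists X, Y, Z, (k / 2), eps. split; [exact He|]. intros ga Hg. specialize (H _ Hg).
  replace (m11 ga0 + (ga - ga0) * (- c * tau / dd)) with (m11 ga) in H by (unfold m11; ring).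
  replace (m21 ga0 + (ga - ga0) * (1 / dd)) with (m21 ga) in H by (unfold m21; ring).
  rewrite !Rmult_0_r, !Rplus_0_r in H. exact H.
Qed.

(* Near each rest point [M(x)] is a small perturbation of a hyperbolic constant matrix, whose
   Lyapunov form controls the square integral of the decaying solution on that tail. *)
Lemma derivatives_RInt_bounded : RInt_bounded (fun x => Derive U x ^ 2 + Derive V x ^ 2).
Proof.
  destruct Hbist as [al [_ [_ [_ [_ [Hd0 [Hd1 _]]]]]]].
  destruct gU_limits as [Hg0 Hg1].
  destruct derivatives_vanish_at_infty as [HUm [HUp [HVm HVp]]].
  destruct (lyapunov_form_near_rest _ Hd0) as [X0 [Y0 [Z0 [k0 [e0 [He0 HL0]]]]]].
  destruct (lyapunov_form_near_rest _ Hd1) as [X1 [Y1 [Z1 [k1 [e1 [He1 HL1]]]]]].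
  destruct (is_lim_m_infty_abs _ _ Hg0 e0 He0) as [M0 HM0].
  destruct (is_lim_p_infty_abs _ _ Hg1 e1 He1) as [M1 HM1].
  destruct (solves2_RInt_tail_m _ _ _ _ _ _ (M0 - 1) X0 Y0 Z0 k0 profile_derivatives_solve)
    as [B0 HB0]; auto.
  { intros x Hx. apply HL0, HM0. lra. }
  destruct (solves2_RInt_tail_p _ _ _ _ _ _ (M1 + 1) X1 Y1 Z1 k1 profile_derivatives_solve)
    as [B1 HB1]; auto.
  { intros x Hx. apply HL1, HM1. lra. }
  apply (RInt_bounded_of_tails _ (M0 - 1) (M1 + 1) B0 B1); auto.
  - intros x. destruct (derivatives_continuous x).
    apply continuous_sum_sq; assumption.
  - intros x. pose proof (pow2_ge_0 (Derive U x)). pose proof (pow2_ge_0 (Derive V x)). lra.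
Qed.

Lemma derivatives_H2 : H2C2 (fun x => (RtoC (Derive U x), RtoC (Derive V x))).
Proof.
  destruct coefficients_C1_bounded as [H11 [H12 [H21 H22]]].
  pose proof derivatives_RInt_bounded as HB.
  split; simpl.
  - exact (H2C_of_solves2 _ _ _ _ _ _ H11 H12 H21 H22 profile_derivatives_solve HB).
  - apply (H2C_of_solves2 _ _ _ _ _ (Derive U) H22 H21 H12 H11
      (solves2_swap _ _ _ _ _ _ profile_derivatives_solve)).
    apply (RInt_bounded_le _ (fun x => Derive U x ^ 2 + Derive V x ^ 2) 1);
      [lra| |intros x; lra|exact HB].
    intros x. destruct (derivatives_continuous x).
    apply continuous_sum_sq; assumption.
Qed.

Lemma derive_U_not_identically_zero : exists x, Derive U x <> 0.
Proof.
  apply NNPP. intros Hz.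
  assert (Hc : forall a b, U a = U b).
  { apply eq_of_derive_zero. intros x.
    destruct (Req_dec (Derive U x) 0) as [E|E]; [rewrite <- E; apply U_is_derive|].
    exfalso. apply Hz. exists x. exact E. }
  destruct Hwave as [_ [_ [_ [HUm [_ [HUp _]]]]]].
  pose proof (eq_of_const_is_lim U m_infty (U 0) 0 (fun y => Hc y 0) HUm).
  pose proof (eq_of_const_is_lim U p_infty (U 0) 1 (fun y => Hc y 0) HUp). lra.
Qed.

Lemma linearized_kernel_real y1 y2 h : linearized_system y1 y2 ->
  (forall x, y1 x ^ 2 + y2 x ^ 2 <= h x) -> RInt_bounded h ->
  exists k, forall x, y1 x = k * Derive U x /\ y2 x = k * Derive V x.
Proof.
  intros Hy Hh HB.
  destruct coefficients_bounded as [B11 [B12 [B21 B22]]].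
  destruct derivatives_bounded as [BU BV].
  destruct derive_U_not_identically_zero as [x0 Hx0].
  apply (solves2_proportional _ _ _ _ _ _ _ _ h B11 B12 B21 B22 profile_derivatives_solve Hy BU BV);
    auto using trace_eventually_signed.
  exists x0. auto.
Qed.

Lemma kernel_equations_solve x w1 w2 a b :
  c * a + b + gU x * w1 = 0 -> a + c * tau * b - w2 = 0 ->
  a = m11 (gU x) * w1 + m12 * w2 /\ b = m21 (gU x) * w1 + m22 * w2.
Proof.
  intros E1 E2. pose proof speed_dd_neq0 as Hd. fold dd in Hd.
  destruct (profile_solve _ _ _ _ E1 E2) as [-> ->].
  unfold m11, m12, m21, m22. split; field; exact Hd.
Qed.

Lemma derivatives_is_Lop :
  is_Lop f c tau U (fun x => (RtoC (Derive U x), RtoC (Derive V x))) (fun _ => (RtoC 0, RtoC 0)).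
Proof.
  pose proof speed_dd_neq0 as Hd. fold dd in Hd.
  exists (fun x => RtoC (m11 (gU x) * Derive U x + m12 * Derive V x)),
    (fun x => RtoC (m21 (gU x) * Derive U x + m22 * Derive V x)).
  split; [intros x; apply is_derive_RtoC, (profile_derivatives_solve x)|].
  split; [intros x; apply is_derive_RtoC, (profile_derivatives_solve x)|].
  intros x. unfold RtoC, Copp, Cplus, Cmult. cbn [fst snd].
  unfold m11, m12, m21, m22, gU, dd in *. f_equal; f_equal; field; lra.
Qed.

Lemma is_Lop_zero_parts w : is_Lop f c tau U w (fun _ => (RtoC 0, RtoC 0)) ->
  linearized_system (fun x => fst (fst (w x))) (fun x => fst (snd (w x))) /\
  linearized_system (fun x => snd (fst (w x))) (fun x => snd (snd (w x))).
Proof.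
  intros [d1 [d2 [Hd1 [Hd2 He]]]].
  assert (Eqs : forall x,
    (fst (d1 x) = m11 (gU x) * fst (fst (w x)) + m12 * fst (snd (w x)) /\
     fst (d2 x) = m21 (gU x) * fst (fst (w x)) + m22 * fst (snd (w x))) /\
    (snd (d1 x) = m11 (gU x) * snd (fst (w x)) + m12 * snd (snd (w x)) /\
     snd (d2 x) = m21 (gU x) * snd (fst (w x)) + m22 * snd (snd (w x)))).
  { intros x. specialize (He x).
    pose proof (f_equal (fun p => fst (fst p)) He) as F1.
    pose proof (f_equal (fun p => fst (snd p)) He) as F2.
    pose proof (f_equal (fun p => snd (fst p)) He) as F3.
    pose proof (f_equal (fun p => snd (snd p)) He) as F4.
    unfold RtoC, Copp, Cplus, Cmult in F1, F2, F3, F4. cbn [fst snd] in F1, F2, F3, F4.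
    assert (Hinv : forall E, 0 = - / tau * E -> E = 0).
    { intros E HE. destruct (Rmult_integral _ _ (eq_sym HE)) as [H|H]; [|exact H].
      exfalso. apply (Rinv_neq_0_compat tau); lra. }
    rewrite ?Rmult_0_l, ?Rplus_0_r, ?Rminus_0_r in F2.
    rewrite ?Rmult_0_l, ?Rplus_0_r, ?Rminus_0_r in F4.
    apply Hinv in F2, F4.
    split; apply kernel_equations_solve; unfold gU; lra. }
  split; intros x; destruct (Eqs x) as [[E1 E2] [E3 E4]]; split.
  - rewrite <- E1. apply (is_derive_fst_C (fun y => fst (w y))), Hd1.
  - rewrite <- E2. apply (is_derive_fst_C (fun y => snd (w y))), Hd2.
  - rewrite <- E3. apply (is_derive_snd_C (fun y => fst (w y))), Hd1.
  - rewrite <- E4. apply (is_derive_snd_C (fun y => snd (w y))), Hd2.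
Qed.

Lemma Lop_kernel_proportional w : H2C2 w -> is_Lop f c tau U w (fun _ => (RtoC 0, RtoC 0)) ->
  exists k : C, forall x, w x = (Cmult k (RtoC (Derive U x)), Cmult k (RtoC (Derive V x))).
Proof.
  intros [[a1 [b1 [_ [_ [_ [L1 _]]]]]] [a2 [b2 [_ [_ [_ [L2 _]]]]]]] HL.
  destruct (is_Lop_zero_parts w HL) as [Hre Him].
  set (h := fun x => Cmod (fst (w x)) ^ 2 + Cmod (snd (w x)) ^ 2).
  assert (HB : RInt_bounded h)
    by (apply RInt_bounded_plus; apply RInt_bounded_of_ex_RInt_gen; auto using pow2_ge_0).
  assert (Hh : forall x, fst (fst (w x)) ^ 2 + fst (snd (w x)) ^ 2 <= h x /\
                        snd (fst (w x)) ^ 2 + snd (snd (w x)) ^ 2 <= h x).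
  { intros x. unfold h. rewrite !Cmod_sq.
    pose proof (pow2_ge_0 (fst (fst (w x)))). pose proof (pow2_ge_0 (fst (snd (w x)))).
    pose proof (pow2_ge_0 (snd (fst (w x)))). pose proof (pow2_ge_0 (snd (snd (w x)))). lra. }
  destruct (linearized_kernel_real _ _ h Hre (fun x => proj1 (Hh x)) HB) as [kr Hkr].
  destruct (linearized_kernel_real _ _ h Him (fun x => proj2 (Hh x)) HB) as [ki Hki].
  exists (kr, ki). intros x. unfold RtoC, Cmult. cbn [fst snd].
  destruct (Hkr x) as [K1 K2]. destruct (Hki x) as [K3 K4].
  destruct (w x) as [[a b] [e g]]. cbn [fst snd] in *.
  rewrite K1, K2, K3, K4. f_equal; f_equal; ring.
Qed.

End TravelingWave.

Theorem lemma3p7 (f : R -> R) (Hsmooth : smooth f) (Hbist : bistable f)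
  (tau : R) (Htau : 0 < tau < tau_m f)
  (c : R) (U V : R -> R) (Hwave : traveling_wave f tau c U V) :
  let Phi : R -> C * C := fun x => (RtoC (Derive U x), RtoC (Derive V x)) in
  H2C2 Phi /\
  (exists x, Phi x <> (RtoC 0, RtoC 0)) /\
  is_Lop f c tau U Phi (fun _ => (RtoC 0, RtoC 0)) /\
  (forall w : R -> C * C,
     H2C2 w -> is_Lop f c tau U w (fun _ => (RtoC 0, RtoC 0)) ->
     exists k : C, forall x, w x = (Cmult k (fst (Phi x)), Cmult k (snd (Phi x)))).
Proof.
  intros Phi. destruct Htau as [Htau0 _].
  split; [exact (derivatives_H2 f tau c U V Hsmooth Hbist Htau0 Hwave)|].
  split.
  - destruct (derive_U_not_identically_zero f tau c U V Hwave) as [x Hx].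
    exists x. intros E. apply Hx. injection E. auto.
  - split; [exact (derivatives_is_Lop f tau c U V Hsmooth Hbist Htau0 Hwave)|].
    exact (Lop_kernel_proportional f tau c U V Hsmooth Hbist Htau0 Hwave).
Qed.
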